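(* Let $(M,P)$ be a holomorphic Poisson manifold of complex dimension $n$ endowed with a holomorphic volume form $\omega$, and write $P=P_{\mathbb{R}}+iP_{\mathbb{I}}$ with $P_{\mathbb{R}},P_{\mathbb{I}}$ the real and imaginary parts of $P$, which define real Poisson structures on the underlying real manifold. Let $f\in\mathcal{O}(M)$. Then $\alpha\in\mathcal{O}(M)$ is a holomorphic last multiplier for the holomorphic Hamiltonian vector field $Z_{\log f}$ if and only if $|\alpha|^2$ is a real last multiplier for both real vector fields $\frac{1}{|f|^2}Z^{\mathbb{R}}_{|f|^2}$ and $\frac{1}{|f|^2}Z^{\mathbb{I}}_{|f|^2}$.
   Context: $\mathcal{O}(M)$ denotes the holomorphic functions on $M$. A holomorphic Poisson structure on a complex manifold $M$ is a bivector field $P\in\Gamma(\bigwedge^2T^{1,0}M)$ with $\overline\partial P=0$ and $[P,P]=0$ (Schouten–Nijenhuis bracket); the bracket of holomorphic functions is $\{u,v\}=P(\partial u,\partial v)$. The holomorphic Hamiltonian vector field of a holomorphic function $u$ is $Z_u=\{u,\cdot\}$, locally $Z_u=\sum_{i,j}P^{ij}\frac{\partial u}{\partial z^i}\frac{\partial}{\partial z^j}$ with $P^{ij}=\{z^i,z^j\}$. The vector field $Z_{\log f}$ is given locally by $Z_{\log f}=\frac1f\sum_{i,j}P^{ij}\frac{\partial f}{\partial z^i}\frac{\partial}{\partial z^j}$. In local complex coordinates $z^j=x^j+ix^{n+j}$, $j=1,\ldots,n$, the real Poisson structures $P_{\mathbb{R}}$, $P_{\mathbb{I}}$ are given by $\{x^i,x^j\}_{\mathbb{R}}=\frac14\mathrm{Re}\{z^i,z^j\}$,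 $\{x^i,x^{n+j}\}_{\mathbb{R}}=\frac14\mathrm{Im}\{z^i,z^j\}$, $\{x^{n+i},x^{n+j}\}_{\mathbb{R}}=-\frac14\mathrm{Re}\{z^i,z^j\}$, and $\{x^i,x^j\}_{\mathbb{I}}=\frac14\mathrm{Im}\{z^i,z^j\}$, $\{x^i,x^{n+j}\}_{\mathbb{I}}=-\frac14\mathrm{Re}\{z^i,z^j\}$, $\{x^{n+i},x^{n+j}\}_{\mathbb{I}}=-\frac14\mathrm{Im}\{z^i,z^j\}$. For a smooth function $u$ on $M$, $Z^{\mathbb{R}}_u=\{u,\cdot\}_{\mathbb{R}}$ and $Z^{\mathbb{I}}_u=\{u,\cdot\}_{\mathbb{I}}$ are its real Hamiltonian vector fields with respect to $P_{\mathbb{R}}$ and $P_{\mathbb{I}}$. A holomorphic volume form is a nowhere vanishing holomorphic $n$-form. A function $\alpha\in\mathcal{O}(M)$ is a holomorphic last multiplier for a holomorphic vector field $Z$ if $\partial(\alpha\,\imath_Z\omega)=0$, where $d=\partial+\overline\partial$ and $\imath_Z$ is the interior product. A function $m\in C^\infty(M;\mathbb{R})$ is a real last multiplier for a real vector field $X$ if $d(m\,\imath_X(\omega\wedge\overline{\omega}))=0$. *)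

(* Defs.v *)
From HB Require Import structures.
From mathcomp Require Import all_boot all_order all_algebra all_fingroup.
From mathcomp Require Import all_classical all_reals all_analysis.
From mathcomp Require Import complex.

Set Implicit Arguments.
Unset Strict Implicit.
Unset Printing Implicit Defensive.

Import Order.TTheory GRing.Theory Num.Theory.
Import numFieldNormedType.Exports.

Local Open Scope classical_set_scope.
Local Open Scope ring_scope.

(** * Calculus on C^n

    C^n is 'rV[R]_(n + n) with z^j = x^j + i x^(n+j).  The index [inl j] stands
    for x^j in a real frame and for z^j in a complex frame; [inr j] stands for
    x^(n+j), respectively for the conjugate of z^j. *)

Notation coords R n := 'rV[R]_(n + n).
Notation idx n := ('I_n + 'I_n)%type.

Definition evec (R : realType) (n : nat) (a : idx n) : coords R n :=
  delta_mx 0 (unsplit a).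

Definition zcoord (R : realType) (n : nat) (a : idx n) (x : coords R n) : R[i] :=
  match a with
  | inl j => (x 0 (lshift n j) +i* x 0 (rshift n j))%C
  | inr j => (x 0 (lshift n j) -i* x 0 (rshift n j))%C
  end.

Definition rpartial (R : realType) (n : nat) (a : idx n)
    (u : coords R n -> R) (x : coords R n) : R :=
  'D_(evec R a) u x.

Definition cpartial (R : realType) (n : nat) (a : idx n)
    (u : coords R n -> R[i]) (x : coords R n) : R[i] :=
  (rpartial a (fun y => complex.Re (u y)) x +i*
   rpartial a (fun y => complex.Im (u y)) x)%C.

(* Wirtinger derivatives *)
Definition wirtinger (R : realType) (n : nat) (a : idx n)
    (u : coords R n -> R[i]) (x : coords R n) : R[i] :=
  match a with
  | inl j => (cpartial (inl j) u x - 'i%C * cpartial (inr j) u x) / 2%:R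
  | inr j => (cpartial (inl j) u x + 'i%C * cpartial (inr j) u x) / 2%:R
  end.

(* Meant for open U: continuity and derivatives are taken in the ambient space,
   so values of u outside U play no role. *)
Fixpoint Ck_on (R : realType) (n : nat) (k : nat)
    (U : set (coords R n)) (u : coords R n -> R) : Prop :=
  (forall x, U x -> {for x, continuous u}) /\
  match k with
  | 0 => True
  | k'.+1 => forall a : idx n,
      (forall x, U x -> derivable u x (evec R a)) /\ Ck_on k' U (rpartial a u)
  end.

Definition smooth_on (R : realType) (n : nat)
    (U : set (coords R n)) (u : coords R n -> R) : Prop :=
  forall k, Ck_on k U u.

Definition holomorphic_on (R : realType) (n : nat)
    (U : set (coords R n)) (u : coords R n -> R[i]) : Prop :=
  [/\ smooth_on U (fun x => complex.Re (u x)),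
      smooth_on U (fun x => complex.Im (u x)) &
      forall x, U x -> forall j : 'I_n, wirtinger (inr j) u x = 0].

(** * Complex manifolds *)

Record chart (R : realType) (n : nat) (T : topologicalType) := Chart {
  cdom : set T;
  cmap : T -> coords R n;
  cinv : coords R n -> T;
  cdom_open : open cdom;
  cimg_open : open (cmap @` cdom);
  cmapK : {in cdom, cancel cmap cinv};
  cmap_continuous : forall p, cdom p -> {for p, continuous cmap};
  cinv_continuous : forall x, (cmap @` cdom) x -> {for x, continuous cinv}
}.

Record complex_manifold (R : realType) (n : nat) := ComplexManifold {
  msort :> topologicalType;
  mhausdorff : hausdorff_space msort;
  msecond_countable : @second_countable msort;
  cidx : Type;
  mchart : cidx -> chart R n msort;
  mchart_cover : forall p : msort, exists c, cdom (mchart c) p;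
  mchart_compat : forall (c c' : cidx) (j : 'I_n),
    holomorphic_on (cmap (mchart c) @` (cdom (mchart c) `&` cdom (mchart c')))
      (fun x => zcoord (inl j) (cmap (mchart c') (cinv (mchart c) x)))
}.

Arguments mchart {R n M} c : rename.

(* the part of U lying in the domain of the chart c, read in that chart *)
Definition in_chart (R : realType) (n : nat) (M : complex_manifold R n)
    (c : cidx M) (U : set M) : set (coords R n) :=
  cmap (mchart c) @` (U `&` cdom (mchart c)).

Definition loc (R : realType) (n : nat) (M : complex_manifold R n) (V : Type)
    (u : M -> V) (c : cidx M) : coords R n -> V :=
  fun x => u (cinv (mchart c) x).

(* C^oo(M; R) *)
Definition smooth_fun (R : realType) (n : nat) (M : complex_manifold R n)
    (u : M -> R) : Prop :=
  forall c, smooth_on (in_chart c setT) (loc u c).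

(* O(M) *)
Definition holomorphic_fun (R : realType) (n : nat) (M : complex_manifold R n)
    (u : M -> R[i]) : Prop :=
  forall c, holomorphic_on (in_chart c setT) (loc u c).

(* derivative of the coordinate a of the chart c' along the coordinate b of c,
   as a function of the coordinates of c *)
Definition jacobian (R : realType) (n : nat) (M : complex_manifold R n)
    (c c' : cidx M) (a b : idx n) (x : coords R n) : R[i] :=
  wirtinger b (fun y => zcoord a (cmap (mchart c') (cinv (mchart c) y))) x.

(** * Tensor fields, given by their components in every chart *)

(* components on d/dz^j and d/d(conj z^j) *)
Definition cvfield (R : realType) (n : nat) (M : complex_manifold R n) :=
  cidx M -> coords R n -> idx n -> R[i].

(* components on d/dx^j and d/dx^(n+j) *)
Definition rvfield (R : realType) (n : nat) (M : complex_manifold R n) :=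
  cidx M -> coords R n -> idx n -> R.

Definition cvfield_of_real (R : realType) (n : nat) (M : complex_manifold R n)
    (X : rvfield M) : cvfield M :=
  fun c x a => match a with
  | inl j => (X c x (inl j) +i* X c x (inr j))%C
  | inr j => (X c x (inl j) -i* X c x (inr j))%C
  end.

(* {x^a, x^b} *)
Definition rbivector (R : realType) (n : nat) (M : complex_manifold R n) :=
  cidx M -> coords R n -> idx n -> idx n -> R.

(* [eta c x t] is the value of eta on the frame vectors of indices
   t 0, ..., t (k - 1) taken from d/dz^j, d/d(conj z^j). *)
Definition cform (R : realType) (n : nat) (M : complex_manifold R n) (k : nat) :=
  cidx M -> coords R n -> {ffun 'I_k -> idx n} -> R[i].

Definition form_scale (R : realType) (n : nat) (M : complex_manifold R n)
    (k : nat) (u : M -> R[i]) (eta : cform M k) : cform M k :=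
  fun c x t => loc u c x * eta c x t.

Definition idx_bar (n : nat) (a : idx n) : idx n :=
  match a with inl j => inr j | inr j => inl j end.

Definition form_conj (R : realType) (n : nat) (M : complex_manifold R n)
    (k : nat) (eta : cform M k) : cform M k :=
  fun c x t => conjc (eta c x [ffun i => idx_bar (t i)]).

Definition wedge (R : realType) (n : nat) (M : complex_manifold R n)
    (k l : nat) (eta : cform M k) (theta : cform M l) : cform M (k + l) :=
  fun c x t =>
    ((k`! * l`!)%:R)^-1 *
    \sum_(s : 'S_(k + l)) (-1) ^+ s *
      eta c x [ffun i => t (s (lshift l i))] *
      theta c x [ffun j => t (s (rshift k j))].

Definition idx_cons (n k : nat) (a : idx n) (t : {ffun 'I_k -> idx n}) :
    {ffun 'I_k.+1 -> idx n} :=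
  [ffun i => if unlift ord0 i is Some j then t j else a].

(* the interior product of a function being 0 *)
Definition interior (R : realType) (n : nat) (M : complex_manifold R n)
    (Z : cvfield M) (k : nat) : cform M k -> cform M k.-1 :=
  match k with
  | 0 => fun _ _ _ _ => 0
  | k'.+1 => fun eta c x t => \sum_(a : idx n) Z c x a * eta c x (idx_cons a t)
  end.

Definition idx_del (n k : nat) (i : 'I_k.+1) (t : {ffun 'I_k.+1 -> idx n}) :
    {ffun 'I_k -> idx n} :=
  [ffun j => t (lift i j)].

Definition del (R : realType) (n : nat) (M : complex_manifold R n) (k : nat)
    (eta : cform M k) : cform M k.+1 :=
  fun c x t =>
    \sum_(i < k.+1) (-1) ^+ i *
      (if t i is inl j then wirtinger (inl j) (fun y => eta c y (idx_del i t)) x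
       else 0).

Definition delbar (R : realType) (n : nat) (M : complex_manifold R n) (k : nat)
    (eta : cform M k) : cform M k.+1 :=
  fun c x t =>
    \sum_(i < k.+1) (-1) ^+ i *
      (if t i is inr j then wirtinger (inr j) (fun y => eta c y (idx_del i t)) x
       else 0).

Definition extd (R : realType) (n : nat) (M : complex_manifold R n) (k : nat)
    (eta : cform M k) : cform M k.+1 :=
  fun c x t => del eta c x t + delbar eta c x t.

Definition vanishes_on (R : realType) (n : nat) (M : complex_manifold R n)
    (k : nat) (U : set M) (eta : cform M k) : Prop :=
  forall c x, in_chart c U x -> forall t, eta c x t = 0.

(** * Holomorphic volume forms *)

Record holomorphic_volume (R : realType) (n : nat) (M : complex_manifold R n) :=
  HolomorphicVolume {
  vform :> cform M n;
  vform_alternating : forall c x, in_chart c setT x ->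
    forall (t : {ffun 'I_n -> idx n}) (s : 'S_n),
      vform c x [ffun i => t (s i)] = (-1) ^+ s * vform c x t;
  (* type (n, 0) *)
  vform_type : forall c x, in_chart c setT x ->
    forall (t : {ffun 'I_n -> idx n}) (i : 'I_n) (j : 'I_n),
      t i = inr j -> vform c x t = 0;
  vform_holomorphic : forall c t,
    holomorphic_on (in_chart c setT) (fun x => vform c x t);
  vform_transition : forall (c c' : cidx M) (p : M),
    cdom (mchart c) p -> cdom (mchart c') p ->
    forall t, vform c (cmap (mchart c) p) t =
      \sum_(s : {ffun 'I_n -> idx n})
        (\prod_(i < n) jacobian c c' (s i) (t i) (cmap (mchart c) p)) *
        vform c' (cmap (mchart c') p) s;
  vform_neq0 : forall c x, in_chart c setT x -> exists t, vform c x t != 0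
}.

(** * Holomorphic Poisson structures *)

(* P = 1/2 \sum_(i, j) P^ij d/dz^i /\ d/dz^j *)
Definition hbivector (R : realType) (n : nat) (M : complex_manifold R n) :=
  cidx M -> coords R n -> 'I_n -> 'I_n -> R[i].

(* The Schouten-Nijenhuis bracket of two holomorphic bivector fields, up to an
   overall sign on which authors disagree. *)
Definition schouten (R : realType) (n : nat) (M : complex_manifold R n)
    (P Q : hbivector M) (c : cidx M) (x : coords R n) (i j k : 'I_n) : R[i] :=
  let term (i j k : 'I_n) := \sum_(l < n)
    (P c x i l * wirtinger (inl l) (fun y => Q c y j k) x +
     Q c x i l * wirtinger (inl l) (fun y => P c y j k) x) in
  term i j k + term j k i + term k i j.

Record holomorphic_poisson (R : realType) (n : nat) (M : complex_manifold R n) :=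
  HolomorphicPoisson {
  pbiv :> hbivector M;
  pbiv_skew : forall c x, in_chart c setT x ->
    forall i j, pbiv c x i j = - pbiv c x j i;
  pbiv_holomorphic : forall c i j,
    holomorphic_on (in_chart c setT) (fun x => pbiv c x i j);
  pbiv_transition : forall (c c' : cidx M) (p : M),
    cdom (mchart c) p -> cdom (mchart c') p ->
    forall i j, pbiv c' (cmap (mchart c') p) i j =
      \sum_(k < n) \sum_(l < n)
        jacobian c c' (inl i) (inl k) (cmap (mchart c) p) *
        jacobian c c' (inl j) (inl l) (cmap (mchart c) p) *
        pbiv c (cmap (mchart c) p) k l;
  pbiv_schouten : forall c x, in_chart c setT x ->
    forall i j k, schouten pbiv pbiv c x i j k = 0
}.

Definition poissonR (R : realType) (n : nat) (M : complex_manifold R n)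
    (P : hbivector M) : rbivector M :=
  fun c x a b => match a, b with
  | inl i, inl j => complex.Re (P c x i j) / 4%:R
  | inl i, inr j => complex.Im (P c x i j) / 4%:R
  | inr i, inl j => - (complex.Im (P c x j i) / 4%:R)
  | inr i, inr j => - (complex.Re (P c x i j) / 4%:R)
  end.

Definition poissonI (R : realType) (n : nat) (M : complex_manifold R n)
    (P : hbivector M) : rbivector M :=
  fun c x a b => match a, b with
  | inl i, inl j => complex.Im (P c x i j) / 4%:R
  | inl i, inr j => - (complex.Re (P c x i j) / 4%:R)
  | inr i, inl j => complex.Re (P c x j i) / 4%:R
  | inr i, inr j => - (complex.Im (P c x i j) / 4%:R)
  end.

(* {u, .} for the real bivector field Q *)
Definition real_hamiltonian (R : realType) (n : nat) (M : complex_manifold R n)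
    (Q : rbivector M) (u : M -> R) : rvfield M :=
  fun c x b => \sum_(a : idx n) Q c x a b * rpartial a (loc u c) x.

Definition rvfield_scale (R : realType) (n : nat) (M : complex_manifold R n)
    (u : M -> R) (X : rvfield M) : rvfield M :=
  fun c x a => loc u c x * X c x a.

(* Meaningful on {f != 0} only. *)
Definition hamiltonian_log (R : realType) (n : nat) (M : complex_manifold R n)
    (P : hbivector M) (f : M -> R[i]) : cvfield M :=
  fun c x a => match a with
  | inl j => (loc f c x)^-1 *
      \sum_(i < n) P c x i j * wirtinger (inl i) (loc f c) x
  | inr _ => 0
  end.

Definition sqmod (R : realType) (z : R[i]) : R :=
  complex.Re z ^+ 2 + complex.Im z ^+ 2.

(** * Last multipliers, for a vector field defined on the open set U *)

Definition holomorphic_last_multiplier (R : realType) (n : nat)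
    (M : complex_manifold R n) (omega : cform M n) (U : set M) (Z : cvfield M)
    (alpha : M -> R[i]) : Prop :=
  holomorphic_fun alpha /\
  vanishes_on U (del (form_scale alpha (interior Z omega))).

Definition real_last_multiplier (R : realType) (n : nat)
    (M : complex_manifold R n) (omega : cform M n) (U : set M) (X : rvfield M)
    (m : M -> R) : Prop :=
  smooth_fun m /\
  vanishes_on U
    (extd (form_scale (fun p => (m p)%:C%C)
      (interior (cvfield_of_real X) (wedge omega (form_conj omega))))).

(* Main.v *)
Require Import Defs.
From HB Require Import structures.
From mathcomp Require Import all_boot all_order all_algebra all_fingroup.
From mathcomp Require Import all_classical all_reals all_analysis.
From mathcomp Require Import complex ring.

Import Order.TTheory GRing.Theory Num.Theory.
Import numFieldNormedType.Exports.
Local Open Scope classical_set_scope.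
Local Open Scope ring_scope.

Set Implicit Arguments.
Unset Strict Implicit.
Unset Printing Implicit Defensive.

(** Work in a chart and put h = omega(d/dz^1, ..., d/dz^n), g = alpha h and
    Z = Z_(log f).  A form of top degree is a density times a determinant: h for
    omega ([volume_frame]) and |h|^2 for omega /\ conj omega
    ([wedge_conj_frame], a Laplace expansion).  For such forms the derivative of
    the contraction with a field is the divergence of the field multiplied by
    the density ([top_form_divergence], which rests on Cramer's rule).  So alpha
    is a holomorphic last multiplier exactly when
      S = sum_j d/dz^j (g Z^j)
    vanishes on the set where f is nonzero ([del_hamiltonian_log]).

    On the real side, d/dz^i |f|^2 = conj f d/dz^i f.  Hence the components on
    d/dz^j of the two real fields, the Hamiltonian fields of |f|^2 divided by
    |f|^2, are Z^j / 2 for P_R and -i Z^j / 2 for P_I ([hamiltonian_sqmod]).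
    The multiplier |alpha|^2 together with the density |h|^2 gives g conj g, and
    d/dz^j kills conj g.  The two real divergences are therefore the real and
    the imaginary part of conj g S ([extd_real_hamiltonian]), and |alpha|^2 is a
    last multiplier of both fields exactly when conj g S = 0.

    It remains to cancel conj g, although g may have zeros.  The set where S is
    nonzero is open and g vanishes on it; but S is a sum of derivatives of
    multiples of g, so it vanishes there as well and this set is empty
    ([weighted_divergence_eq0]). *)

(** * Smooth calculus with complex values *)

Section ReIm.
Variable R : realType.
Implicit Types z w : R[i].

Lemma ReD z w : complex.Re (z + w) = complex.Re z + complex.Re w.
Proof. by case: z w => ? ? []. Qed.

Lemma ImD z w : complex.Im (z + w) = complex.Im z + complex.Im w.
Proof. by case: z w => ? ? []. Qed.

Lemma ReM z w : complex.Re (z * w) =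
  complex.Re z * complex.Re w - complex.Im z * complex.Im w.
Proof. by case: z w => ? ? []. Qed.

Lemma ImM z w : complex.Im (z * w) =
  complex.Re z * complex.Im w + complex.Im z * complex.Re w.
Proof. by case: z w => ? ? []. Qed.

Lemma ReJ z : complex.Re (conjc z) = complex.Re z.
Proof. by case: z. Qed.

Lemma ImJ z : complex.Im (conjc z) = - complex.Im z.
Proof. by case: z. Qed.

Lemma conjcD z w : conjc (z + w) = conjc z + conjc w.
Proof. exact: (rmorphD (@conjc R)). Qed.

Lemma conjcM z w : conjc (z * w) = conjc z * conjc w.
Proof. exact: (rmorphM (@conjc R)). Qed.

Lemma conjc_half : conjc (2%:R^-1 : R[i]) = 2%:R^-1.
Proof. by rewrite conjc_inv conjc_nat. Qed.

Lemma conjc_i : conjc ('i%C : R[i]) = - 'i%C.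
Proof. by simpc. Qed.

End ReIm.

Section SmoothCalculus.
Variables (R : realType) (n : nat) (U : set (coords R n)).
Hypothesis Uo : open U.
Implicit Types (u v : coords R n -> R) (x : coords R n) (a : idx n).

Lemma near_eq_on (V : Type) (u v : coords R n -> V) x :
  (forall y, U y -> u y = v y) -> U x -> {near x, u =1 v}.
Proof.
by move=> uv Ux; apply: filterS (open_nbhs_nbhs (conj Uo Ux)) => y /uv.
Qed.

Lemma rpartial_eq_on u v x a :
  (forall y, U y -> u y = v y) -> U x -> rpartial a u x = rpartial a v x.
Proof. by move=> uv Ux; apply: near_eq_derive; exact: near_eq_on. Qed.

Lemma continuous_eq_on u v x : (forall y, U y -> u y = v y) -> U x ->
  {for x, continuous u} -> {for x, continuous v}.
Proof.
move=> uv Ux; rewrite /prop_for /continuous_at -(uv _ Ux) => cu.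
apply: cvg_trans cu.
exact: (near_eq_cvg (F := nbhs x) (near_eq_on uv Ux)).
Qed.

Lemma Ck_on_eq k u v :
  (forall y, U y -> u y = v y) -> Ck_on k U u -> Ck_on k U v.
Proof.
elim: k u v => [|k IH] u v uv /= [cu du]; split=> //.
- by move=> x Ux; apply: continuous_eq_on (cu x Ux).
- by move=> x Ux; apply: continuous_eq_on (cu x Ux).
move=> a; have [dua Cua] := du a; split=> [x Ux|].
  by apply: near_eq_derivable (dua x Ux); exact: near_eq_on.
by apply: IH Cua => y Uy; exact: rpartial_eq_on.
Qed.

Lemma Ck_on_continuous k u x : Ck_on k U u -> U x -> {for x, continuous u}.
Proof. by case: k => [|k] [cu _]; exact: cu. Qed.

Lemma Ck_onS k u : Ck_on k.+1 U u -> Ck_on k U u.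
Proof.
elim: k u => [|k IH] u [cu du]; split=> // a.
by have [dua Cua] := du a; split=> //; exact: IH.
Qed.

Lemma Ck_on_cst k (r : R) : Ck_on k U (fun=> r).
Proof.
elim: k r => [|k IH] r; split=> //; try by move=> x _; exact: cst_continuous.
move=> a; split=> [x _|]; first exact: derivable_cst.
by apply: Ck_on_eq (IH 0) => y _; rewrite /rpartial derive_cst.
Qed.

Lemma Ck_onD k u v :
  Ck_on k U u -> Ck_on k U v -> Ck_on k U (fun x => u x + v x).
Proof.
elim: k u v => [|k IH] u v Cu Cv.
  by split=> // x Ux; apply: continuousD; apply: Ck_on_continuous Ux; eassumption.
split=> [x Ux|a].
  by apply: continuousD; apply: Ck_on_continuous Ux; eassumption.
have [/= _ /(_ a)[du Cdu]] := Cu; have [/= _ /(_ a)[dv Cdv]] := Cv.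
split=> [x Ux|]; first by apply: derivableD; [exact: du | exact: dv].
apply: Ck_on_eq (IH _ _ Cdu Cdv) => y Uy.
by rewrite /rpartial -deriveD //; [exact: du | exact: dv].
Qed.

Lemma rpartialM u v x a : derivable u x (evec R a) -> derivable v x (evec R a) ->
  rpartial a (fun y => u y * v y) x = u x * rpartial a v x + v x * rpartial a u x.
Proof. by move=> du dv; rewrite /rpartial (deriveM du dv). Qed.

Lemma Ck_onM k u v :
  Ck_on k U u -> Ck_on k U v -> Ck_on k U (fun x => u x * v x).
Proof.
elim: k u v => [|k IH] u v Cu Cv.
  by split=> // x Ux; apply: continuousM; apply: Ck_on_continuous Ux; eassumption.
split=> [x Ux|a]; first by apply: continuousM; apply: Ck_on_continuous Ux; eassumption.
have [/= _ /(_ a)[du Cdu]] := Cu; have [/= _ /(_ a)[dv Cdv]] := Cv.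
split=> [x Ux|]; first by apply: derivableM; [exact: du | exact: dv].
have := Ck_onD (IH _ _ (Ck_onS Cu) Cdv) (IH _ _ (Ck_onS Cv) Cdu).
by apply: Ck_on_eq => y Uy; rewrite rpartialM //; [exact: du | exact: dv].
Qed.

(** The derivative of 1/u is - (1/u)^2 times that of u, so one more derivative
    of 1/u costs only the smoothness already obtained for 1/u. *)
Lemma Ck_onV k u : (forall x, U x -> u x != 0) ->
  Ck_on k U u -> Ck_on k U (fun x => (u x)^-1).
Proof.
move=> u0; elim: k => [|k IH] Cu.
  by split=> // x Ux; apply: continuousV; [exact: u0 | apply: Ck_on_continuous Ux; eassumption].
split=> [x Ux|a].
  by apply: continuousV; [exact: u0 | apply: Ck_on_continuous Ux; eassumption].
have [/= _ /(_ a)[du Cdu]] := Cu; have CV := IH (Ck_onS Cu).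
split=> [x Ux|]; first by apply: derivableV; [exact: u0 | exact: du].
have := Ck_onM (Ck_onM (Ck_on_cst k (-1)) (Ck_onM CV CV)) Cdu.
apply: Ck_on_eq => y Uy; rewrite /rpartial deriveV ?u0//; last exact: du.
by rewrite mulN1r -expr2 exprVn.
Qed.

(** Re and Im turn the calculus of complex-valued functions into that of real
    ones, so that no topology on the complex numbers enters. *)
Definition csmooth_on (u : coords R n -> R[i]) : Prop :=
  smooth_on U (fun x => complex.Re (u x)) /\
  smooth_on U (fun x => complex.Im (u x)).

Implicit Types f g : coords R n -> R[i].

Lemma holomorphic_csmooth f : holomorphic_on U f -> csmooth_on f.
Proof. by case. Qed.

Lemma csmooth_on_eq f g :
  (forall y, U y -> f y = g y) -> csmooth_on f -> csmooth_on g.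
Proof.
move=> fg [rf jf]; split=> k; [move: (rf k)|move: (jf k)].
  by apply: Ck_on_eq => y /fg ->.
by apply: Ck_on_eq => y /fg ->.
Qed.

Lemma csmooth_on_cst (z : R[i]) : csmooth_on (fun=> z).
Proof. by split=> k; exact: Ck_on_cst. Qed.

Lemma csmooth_onD f g :
  csmooth_on f -> csmooth_on g -> csmooth_on (fun x => f x + g x).
Proof.
move=> [rf jf] [rg jg]; split=> k.
  apply: Ck_on_eq (Ck_onD (rf k) (rg k)) => y _.
  by rewrite ReD.
apply: Ck_on_eq (Ck_onD (jf k) (jg k)) => y _.
by rewrite ImD.
Qed.

Lemma csmooth_onM f g :
  csmooth_on f -> csmooth_on g -> csmooth_on (fun x => f x * g x).
Proof.
move=> [rf jf] [rg jg]; split=> k.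
  have := Ck_onD (Ck_onM (rf k) (rg k))
                 (Ck_onM (Ck_on_cst k (-1)) (Ck_onM (jf k) (jg k))).
  by apply: Ck_on_eq => y _; rewrite ReM mulN1r.
have := Ck_onD (Ck_onM (rf k) (jg k)) (Ck_onM (jf k) (rg k)).
by apply: Ck_on_eq => y _; rewrite ImM.
Qed.

Lemma csmooth_on_sum (I : Type) (r : seq I) (F : I -> coords R n -> R[i]) :
  (forall i, csmooth_on (F i)) -> csmooth_on (fun x => \sum_(i <- r) F i x).
Proof.
move=> sF; elim: r => [|i r IH].
  by apply: csmooth_on_eq (csmooth_on_cst 0) => y _; rewrite big_nil.
by apply: csmooth_on_eq (csmooth_onD (sF i) IH) => y _; rewrite big_cons.
Qed.

Lemma csmooth_on_conj f : csmooth_on f -> csmooth_on (fun x => conjc (f x)).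
Proof.
move=> [rf jf]; split=> k.
  by apply: Ck_on_eq (rf k) => y _; rewrite ReJ.
apply: Ck_on_eq (Ck_onM (Ck_on_cst k (-1)) (jf k)) => y _.
by rewrite ImJ mulN1r.
Qed.

Lemma smooth_on_sqmod f : csmooth_on f -> smooth_on U (fun x => sqmod (f x)).
Proof.
move=> [rf jf] k; have := Ck_onD (Ck_onM (rf k) (rf k)) (Ck_onM (jf k) (jf k)).
by apply: Ck_on_eq => y _; rewrite -!expr2.
Qed.

Lemma sqmodE (z : R[i]) : (sqmod z)%:C%C = z * conjc z.
Proof.
case: z => a b; rewrite /sqmod; simpc; apply/eqP; rewrite eq_complex /=.
by apply/andP; split; apply/eqP; ring.
Qed.

Lemma sqmod_eq0 (z : R[i]) : (sqmod z == 0) = (z == 0).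
Proof.
by rewrite -(inj_eq (@complexI R)) sqmodE mulf_eq0 conjc_eq0 orbb.
Qed.

(** 1/f = conj f / |f|^2 reduces the inverse to that of a real function. *)
Lemma csmooth_onV f : (forall x, U x -> f x != 0) ->
  csmooth_on f -> csmooth_on (fun x => (f x)^-1).
Proof.
move=> f0 sf.
have sV : csmooth_on (fun x => ((sqmod (f x))^-1)%:C%C).
  split=> k; last exact: Ck_on_cst.
  apply: Ck_onV; last exact: smooth_on_sqmod.
  by move=> x Ux; rewrite sqmod_eq0 f0.
apply: csmooth_on_eq (csmooth_onM (csmooth_on_conj sf) sV) => y Uy.
have -> : ((sqmod (f y))^-1)%:C%C = (f y * conjc (f y))^-1.
  by rewrite -sqmodE; exact: (fmorphV (real_complex R)).
by rewrite invfM mulrCA mulfV ?mulr1 // conjc_eq0 f0.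
Qed.

Lemma smooth_on_rpartial u a : smooth_on U u -> smooth_on U (rpartial a u).
Proof. by move=> su k; have [_ /(_ a)[]] := su k.+1. Qed.

Lemma smooth_on_derivable u x a :
  smooth_on U u -> U x -> derivable u x (evec R a).
Proof. by move=> su; have [_ /(_ a)[+ _]] := su 1%N; apply. Qed.

Lemma csmooth_on_wirtinger f a : csmooth_on f -> csmooth_on (wirtinger a f).
Proof.
move=> [rf jf].
have sc b : csmooth_on (cpartial b f).
  by split; exact: smooth_on_rpartial.
have sMi b (z : R[i]) : csmooth_on (fun x => z * cpartial b f x).
  by apply: csmooth_onM; [exact: csmooth_on_cst | exact: sc].
have half b (z : R[i]) : csmooth_on (fun x =>
    (cpartial (inl b) f x + z * cpartial (inr b) f x) * 2%:R^-1).
  apply: csmooth_onM; last exact: csmooth_on_cst.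
  by apply: csmooth_onD; [exact: sc | exact: sMi].
case: a => j; last exact: half.
by apply: csmooth_on_eq (half j (- 'i%C)) => y _; rewrite /wirtinger mulNr.
Qed.

Lemma cpartial_eq_on f g x a :
  (forall y, U y -> f y = g y) -> U x -> cpartial a f x = cpartial a g x.
Proof.
by move=> fg Ux; congr (_ +i* _)%C; apply: rpartial_eq_on => // y /fg ->.
Qed.

Lemma wirtinger_eq_on f g x a :
  (forall y, U y -> f y = g y) -> U x -> wirtinger a f x = wirtinger a g x.
Proof.
by move=> fg Ux; case: a => j; rewrite /wirtinger !(cpartial_eq_on _ fg Ux).
Qed.

Lemma cpartial_cst (z : R[i]) x a : cpartial a (fun=> z) x = 0.
Proof. by rewrite /cpartial /rpartial !derive_cst. Qed.

Lemma wirtinger_cst (z : R[i]) x a : wirtinger a (fun=> z) x = 0.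
Proof.
by case: a => j; rewrite /wirtinger !cpartial_cst mulr0 ?subr0 ?addr0 mul0r.
Qed.

Lemma rpartialD u v x a : smooth_on U u -> smooth_on U v -> U x ->
  rpartial a (fun y => u y + v y) x = rpartial a u x + rpartial a v x.
Proof. by move=> su sv Ux; apply: deriveD; exact: smooth_on_derivable. Qed.

Lemma rpartialN u x a : smooth_on U u -> U x ->
  rpartial a (fun y => - u y) x = - rpartial a u x.
Proof. by move=> su Ux; apply: deriveN; exact: smooth_on_derivable. Qed.

Lemma cpartialD f g x a : csmooth_on f -> csmooth_on g -> U x ->
  cpartial a (fun y => f y + g y) x = cpartial a f x + cpartial a g x.
Proof.
move=> [rf jf] [rg jg] Ux; rewrite /cpartial.
rewrite (rpartial_eq_on a (fun y _ => ReD (f y) (g y)) Ux) rpartialD //.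
by rewrite (rpartial_eq_on a (fun y _ => ImD (f y) (g y)) Ux) rpartialD.
Qed.

Lemma cpartialM f g x a : csmooth_on f -> csmooth_on g -> U x ->
  cpartial a (fun y => f y * g y) x = cpartial a f x * g x + f x * cpartial a g x.
Proof.
move=> [rf jf] [rg jg] Ux; rewrite /cpartial.
have sM u v : smooth_on U u -> smooth_on U v -> smooth_on U (fun y => u y * v y).
  by move=> su sv k; apply: Ck_onM.
have sN u : smooth_on U u -> smooth_on U (fun y => - u y).
  move=> su k; apply: Ck_on_eq (Ck_onM (Ck_on_cst k (-1)) (su k)) => y _.
  by rewrite mulN1r.
have D u v : smooth_on U u -> smooth_on U v ->
    rpartial a (fun y => u y * v y) x = u x * rpartial a v x + v x * rpartial a u x.
  by move=> su sv; apply: rpartialM; exact: smooth_on_derivable.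
rewrite (rpartial_eq_on a (fun y _ => ReM (f y) (g y)) Ux) rpartialD; last 3 first.
- exact: sM.
- exact/sN/sM.
- exact: Ux.
rewrite rpartialN //; last exact: sM.
rewrite (rpartial_eq_on a (fun y _ => ImM (f y) (g y)) Ux) rpartialD; last 3 first.
- exact: sM.
- exact: sM.
- exact: Ux.
rewrite !D //.
move: (rpartial a (fun y => complex.Re (f y)) x) => rf'.
move: (rpartial a (fun y => complex.Im (f y)) x) => jf'.
move: (rpartial a (fun y => complex.Re (g y)) x) => rg'.
move: (rpartial a (fun y => complex.Im (g y)) x) => jg'.
case: (f x) (g x) => p q [r s] /=; simpc.
by congr (_ +i* _)%C; ring.
Qed.

Lemma cpartial_conj f x a : csmooth_on f -> U x ->
  cpartial a (fun y => conjc (f y)) x = conjc (cpartial a f x).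
Proof.
move=> [rf jf] Ux; rewrite /cpartial.
rewrite (rpartial_eq_on a (fun y _ => ReJ (f y)) Ux).
by rewrite (rpartial_eq_on a (fun y _ => ImJ (f y)) Ux) rpartialN.
Qed.

Lemma wirtingerD f g x a : csmooth_on f -> csmooth_on g -> U x ->
  wirtinger a (fun y => f y + g y) x = wirtinger a f x + wirtinger a g x.
Proof.
move=> sf sg Ux; case: a => j; rewrite /wirtinger !cpartialD // -mulrDl.
  by rewrite mulrDr opprD addrACA.
by rewrite mulrDr addrACA.
Qed.

Lemma wirtingerM f g x a : csmooth_on f -> csmooth_on g -> U x ->
  wirtinger a (fun y => f y * g y) x =
    wirtinger a f x * g x + f x * wirtinger a g x.
Proof.
move=> sf sg Ux; case: a => j; rewrite /wirtinger !cpartialM //;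
  move: (cpartial (inl j) f x) (cpartial (inr j) f x) => p q;
  move: (cpartial (inl j) g x) (cpartial (inr j) g x) (f x) (g x) => r s z w;
  move: 'i%C 2%:R^-1 => i h; ring.
Qed.

Lemma wirtinger_sum (I : Type) (r : seq I) (F : I -> coords R n -> R[i]) x a :
  (forall i, csmooth_on (F i)) -> U x ->
  wirtinger a (fun y => \sum_(i <- r) F i y) x =
    \sum_(i <- r) wirtinger a (F i) x.
Proof.
move=> sF Ux; elim: r => [|i r IH].
  rewrite big_nil; apply: etrans (wirtinger_cst 0 x a).
  by apply: wirtinger_eq_on Ux => y _; rewrite big_nil.
rewrite big_cons -IH -wirtingerD //; last exact: csmooth_on_sum.
by apply: wirtinger_eq_on Ux => y _; rewrite big_cons.
Qed.

(** Conjugation swaps the two kinds of Wirtinger derivatives; on a holomorphic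
    f this says that d/dz^j kills conj f. *)
Lemma wirtinger_conj f x a : csmooth_on f -> U x ->
  wirtinger (idx_bar a) (fun y => conjc (f y)) x = conjc (wirtinger a f x).
Proof.
move=> sf Ux; case: a => j; rewrite /wirtinger /idx_bar !cpartial_conj //.
  by rewrite conjcM conjc_half -mulNr conjcD conjcM -conjc_i conjcK.
by rewrite conjcM conjc_half conjcD conjcM conjc_i mulNr.
Qed.

End SmoothCalculus.

(** * Determinants as top-degree forms *)

Section DeterminantForms.
Variables (C : fieldType) (A : finType) (N : nat) (e : 'I_N -> A).

Definition frame_mx (t : {ffun 'I_N -> A}) : 'M[C]_N :=
  \matrix_(i, k) (t i == e k)%:R.

(** The volume form dual to the frame e, evaluated on the frame vectors of
    indices t. *)
Definition frame_vol (t : {ffun 'I_N -> A}) : C := \det (frame_mx t).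

Lemma frame_vol_frame : injective e -> frame_vol (finfun e) = 1.
Proof.
move=> ei; rewrite /frame_vol -[RHS](det1 C N); congr (\det _).
by apply/matrixP => i k; rewrite !mxE ffunE (inj_eq ei).
Qed.

Lemma frame_vol_perm (t : {ffun 'I_N -> A}) (s : 'S_N) :
  frame_vol [ffun i => t (s i)] = (-1) ^+ s * frame_vol t.
Proof.
rewrite /frame_vol -det_perm -det_mulmx -row_permE; congr (\det _).
by apply/matrixP => i k; rewrite !mxE ffunE.
Qed.

Lemma frame_vol_out (t : {ffun 'I_N -> A}) i :
  (forall k, t i != e k) -> frame_vol t = 0.
Proof.
move=> ti; rewrite /frame_vol (expand_det_row _ i) big1 // => k _.
by rewrite mxE (negPf (ti k)) mul0r.
Qed.

Lemma frame_vol_repeat (t : {ffun 'I_N -> A}) i j :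
  i != j -> t i = t j -> frame_vol t = 0.
Proof.
move=> ij tij; apply: (determinant_alternate ij) => k.
by rewrite !mxE tij.
Qed.

End DeterminantForms.

(** The matrix W i has first row v followed by V deprived of its row i.
    Expanding each determinant along v leaves the product of the adjugate of V
    with V, whence the scalar det V. *)
Lemma Cramer_insert_row (C : comPzRingType) (m : nat) (V : 'M[C]_m.+1)
    (W : 'I_m.+1 -> 'M[C]_m.+1) (v : 'I_m.+1 -> C) (k : 'I_m.+1) :
  (forall i l, W i ord0 l = v l) ->
  (forall i j l, W i (lift ord0 j) l = V (lift i j) l) ->
  \sum_(i < m.+1) (-1) ^+ i * V i k * \det (W i) = v k * \det V.
Proof.
move=> W0 W1.
have detW i : \det (W i) = \sum_l v l * (-1) ^+ i * cofactor V i l.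
  rewrite (expand_det_row _ ord0); apply: eq_bigr => l _.
  rewrite W0 -mulrA; congr (_ * _); rewrite /cofactor mulrA; congr (_ * _).
    by rewrite /= add0n exprD mulrA -expr2 sqrr_sign mul1r.
  by congr (\det _); apply/matrixP => p q; rewrite !mxE W1.
transitivity (\sum_l v l * \sum_i (\adj V) l i * V i k).
  rewrite (eq_bigr (fun i => \sum_l v l * ((\adj V) l i * V i k))).
    by rewrite exchange_big; apply: eq_bigr => l _; rewrite mulr_sumr.
  move=> i _; rewrite detW mulr_sumr; apply: eq_bigr => l _.
  rewrite mxE; have := sqrr_sign C i; set s := (-1) ^+ _ => ss.
  by transitivity (s ^+ 2 * (v l * (cofactor V i l * V i k)));
    [ring | rewrite ss mul1r].
transitivity (\sum_l v l * (\adj V *m V) l k).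
  by apply: eq_bigr => l _; rewrite mxE.
rewrite mul_adj_mx (bigD1 k) //= big1 ?addr0; first by rewrite mxE eqxx mulr1n.
by move=> l lk; rewrite mxE (negPf lk) mulr0n mulr0.
Qed.

(** In terms of forms: e^k /\ (i_a vol) = e^k(a) vol. *)
Lemma frame_vol_contract (C : fieldType) (n m : nat) (e : 'I_m.+1 -> idx n)
    (t : {ffun 'I_m.+1 -> idx n}) (a : idx n) (k : 'I_m.+1) :
  \sum_(i < m.+1) (-1) ^+ i * (t i == e k)%:R * frame_vol C e (idx_cons a (idx_del i t)) =
    (a == e k)%:R * frame_vol C e t.
Proof.
rewrite /frame_vol.
rewrite -(Cramer_insert_row (V := frame_mx C e t)
  (W := fun i => frame_mx C e (idx_cons a (idx_del i t)))
  (v := fun l => (a == e l)%:R)).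
- by apply: eq_bigr => i _; rewrite [frame_mx _ _ _ i k]mxE.
- by move=> i l; rewrite mxE ffunE unlift_none.
- by move=> i j l; rewrite !mxE ffunE liftK ffunE.
Qed.

(** The pair (p, q) as one permutation acting blockwise, which turns a product
    of two Leibniz expansions into terms of a single one. *)
Definition block_fun (k l : nat) (p : 'S_k) (q : 'S_l) (i : 'I_(k + l)) : 'I_(k + l) :=
  match @fintype.split k l i with
  | inl j => lshift l (p j)
  | inr j => rshift k (q j)
  end.

Lemma block_fun_inj k l (p : 'S_k) (q : 'S_l) : injective (block_fun p q).
Proof.
move=> i j; rewrite /block_fun.
case: (fintype.split_ordP i) => i' ->; case: (fintype.split_ordP j) => j' -> /eqP;
  rewrite ?eq_lshift ?eq_rshift ?eq_lrshift ?eq_rlshift // => /eqP /perm_inj -> //.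
Qed.

Definition block_perm k l (p : 'S_k) (q : 'S_l) : 'S_(k + l) :=
  perm (block_fun_inj (p := p) (q := q)).

Lemma block_perml k l (p : 'S_k) (q : 'S_l) i :
  block_perm p q (lshift l i) = lshift l (p i).
Proof. by rewrite permE /block_fun (unsplitK (inl i)). Qed.

Lemma block_permr k l (p : 'S_k) (q : 'S_l) i :
  block_perm p q (rshift k i) = rshift k (q i).
Proof. by rewrite permE /block_fun (unsplitK (inr i)). Qed.

Lemma sign_block_perm (C : comPzRingType) k l (p : 'S_k) (q : 'S_l) :
  (-1) ^+ block_perm p q = (-1) ^+ p * (-1) ^+ q :> C.
Proof.
rewrite -!det_perm -(det_ublock _ 0); congr (\det _).
apply/matrixP => i j.
case: (fintype.split_ordP i) => i' ->; case: (fintype.split_ordP j) => j' ->;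
  rewrite ?block_mxEul ?block_mxEur ?block_mxEdl ?block_mxEdr !mxE;
  by rewrite ?block_perml ?block_permr
    ?eq_lshift ?eq_rshift ?eq_lrshift ?eq_rlshift.
Qed.

(** The Laplace expansion in antisymmetrised form.  After expanding both minors
    over p and q, the sum over s is, up to reindexing by the block permutation
    of p and q, the Leibniz formula of B, whatever p and q are. *)
Lemma det_blocks_antisym (C : comPzRingType) k l (B : 'M[C]_(k + l)) :
  \sum_(s : 'S_(k + l)) (-1) ^+ s *
     \det (\matrix_(i, j) B (s (lshift l i)) (lshift l j)) *
     \det (\matrix_(i, j) B (s (rshift k i)) (rshift k j))
  = (k`! * l`!)%:R * \det B.
Proof.
rewrite /(\det _).
transitivity (\sum_(p : 'S_k) \sum_(q : 'S_l) \sum_(s : 'S_(k + l))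
   (-1) ^+ (s * (block_perm p q)^-1)%g * \prod_i B (s i) (block_perm p q i)).
  under [RHS]eq_bigr => p _ do rewrite exchange_big.
  rewrite exchange_big; apply: eq_bigr => s _.
  rewrite -mulrA mulr_suml mulr_sumr; apply: eq_bigr => p _.
  rewrite !mulr_sumr; apply: eq_bigr => q _.
  rewrite big_split_ord odd_permM odd_permV signr_addb sign_block_perm.
  rewrite -[RHS]mulrA; congr (_ * _).
  rewrite mulrACA; congr (_ * (_ * _)); apply: eq_bigr => i _.
    by rewrite mxE block_perml.
  by rewrite mxE block_permr.
have E (p : 'S_k) (q : 'S_l) : \sum_(s : 'S_(k + l))
   (-1) ^+ (s * (block_perm p q)^-1)%g * \prod_i B (s i) (block_perm p q i)
   = \det B.
  rewrite -det_tr (reindex_inj (mulgI (block_perm p q))) /=.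
  apply: eq_bigr => s _; congr (_ * _).
    by rewrite !odd_permM odd_permV addbAC addbb.
  rewrite [RHS](reindex_inj (@perm_inj _ (block_perm p q))) /=.
  by apply: eq_bigr => i _; rewrite mxE permM.
transitivity (\sum_(p : 'S_k) \sum_(q : 'S_l) \det B).
  by apply: eq_bigr => p _; apply: eq_bigr => q _; exact: E.
by rewrite !sumr_const !card_Sn -mulrnA mulr_natl mulnC.
Qed.

(** * Forms in a chart *)

Section ChartLemmas.
Variables (R : realType) (n : nat).

Lemma Ck_on_sub k (U V : set (coords R n)) (u : coords R n -> R) :
  V `<=` U -> Ck_on k U u -> Ck_on k V u.
Proof.
move=> VU; elim: k u => [|k IH] u /= [cu du]; split=> //.
- by move=> x /VU /cu.
- by move=> x /VU /cu.
by move=> a; have [dua /IH] := du a; split=> // x /VU /dua.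
Qed.

Lemma csmooth_on_sub (U V : set (coords R n)) f :
  V `<=` U -> csmooth_on U f -> csmooth_on V f.
Proof. by move=> VU [rf jf]; split=> k; exact: Ck_on_sub VU _. Qed.

Lemma open_nonzero (V : set (coords R n)) g :
  open V -> csmooth_on V g -> open (V `&` [set x | g x != 0]).
Proof.
move=> Vo sg; rewrite openE => x [Vx gx].
apply: (@filterI _ (nbhs x)); first exact: (open_nbhs_nbhs (conj Vo Vx)).
have cs : {for x, continuous (fun y => sqmod (g y))}.
  exact: (Ck_on_continuous (smooth_on_sqmod Vo sg 0) Vx).
have gx0 : sqmod (g x) != 0 by rewrite sqmod_eq0.
apply: (@filterS _ (nbhs x) _ [set y | sqmod (g y) != 0]).
  by move=> y /=; rewrite sqmod_eq0.
have N : nbhs (sqmod (g x)) [set r : R | r != 0].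
  by apply: open_nbhs_nbhs; split => //; exact: open_neq.
exact: (cs _ N).
Qed.

Variable M : complex_manifold R n.

Lemma in_chart_openT c : open (@in_chart R n M c setT).
Proof. by rewrite /in_chart setTI; apply: cimg_open. Qed.

Lemma in_chart_nonzero c (f : M -> R[i]) :
  in_chart c [set p | f p != 0] =
  in_chart c setT `&` [set x | loc f c x != 0].
Proof.
apply/seteqP; split=> x.
  move=> [p [/= fp cp] <-]; split; first by exists p.
  by rewrite /= /loc cmapK ?inE.
move=> [[p [_ cp] <-]]; rewrite /= /loc cmapK ?inE // => fp.
by exists p.
Qed.

End ChartLemmas.

(** * Exterior derivative and divergence *)

Section Divergence.
Variables (R : realType) (n m : nat) (e : 'I_m.+1 -> idx n).
Variables (V : set (coords R n)) (Vo : open V).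
Hypothesis e_inj : injective e.

(** The formula d (i_X vol) = div X vol, with G the components of the field
    multiplied by the density of the form.  The predicate p selects the
    directions along which one differentiates: those of the frame e.  Thus the
    same statement covers the operator del on (n, 0)-forms, with the n vectors
    d/dz^j, and the full exterior derivative, with all 2n vectors. *)
Lemma top_form_divergence (G : idx n -> coords R n -> R[i])
    (p : pred (idx n)) (t : {ffun 'I_m.+1 -> idx n}) x :
  (forall a, csmooth_on V (G a)) -> V x ->
  (forall a, p a = [exists k, a == e k]) ->
  \sum_(i < m.+1) (-1) ^+ i * (if p (t i) then
     wirtinger (t i) (fun y => \sum_(a : idx n)
       G a y * frame_vol R[i] e (idx_cons a (idx_del i t))) x else 0)
  = frame_vol R[i] e t * \sum_k wirtinger (e k) (G (e k)) x.
Proof.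
move=> sG Vx pE.
pose vol i a := frame_vol R[i] e (idx_cons a (@idx_del n m i t)).
have term i : (if p (t i) then
     wirtinger (t i) (fun y => \sum_(a : idx n) G a y * vol i a) x else 0)
   = \sum_k (t i == e k)%:R * \sum_a wirtinger (e k) (G a) x * vol i a.
  rewrite pE; case: ifPn => [/existsP [k0 /eqP tk] | /existsPn tk].
    rewrite (bigD1 k0) //= tk eqxx mul1r [X in _ = _ + X]big1 ?addr0; last first.
      by move=> k kk; rewrite (inj_eq e_inj) eq_sym (negPf kk) mul0r.
    rewrite (wirtinger_sum Vo) //; last first.
      by move=> a; apply: csmooth_onM => //; exact: csmooth_on_cst.
    apply: eq_bigr => a _; rewrite (wirtingerM Vo) //; last exact: csmooth_on_cst.
    by rewrite wirtinger_cst mulr0 addr0.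
  by rewrite big1 // => k _; rewrite (negPf (tk k)) mul0r.
transitivity (\sum_k \sum_a wirtinger (e k) (G a) x *
    \sum_(i < m.+1) (-1) ^+ i * (t i == e k)%:R * vol i a).
  rewrite (eq_bigr (fun i : 'I_m.+1 => \sum_k \sum_a wirtinger (e k) (G a) x *
      ((-1) ^+ i * (t i == e k)%:R * vol i a))).
    rewrite exchange_big; apply: eq_bigr => k _.
    by rewrite exchange_big; apply: eq_bigr => a _; rewrite mulr_sumr.
  move=> i _; rewrite term mulr_sumr; apply: eq_bigr => k _.
  rewrite mulr_sumr mulr_sumr; apply: eq_bigr => a _.
  move: (wirtinger _ _ _) (vol i a) ((-1) ^+ i) (_ %:R) => w v s d; ring.
rewrite mulr_sumr; apply: eq_bigr => k _.
rewrite (bigD1 (e k)) //= frame_vol_contract eqxx mul1r mulrC.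
rewrite big1 ?addr0 // => a ak.
by rewrite frame_vol_contract (negPf ak) mul0r mulr0.
Qed.

End Divergence.

(** * The volume forms omega and omega /\ conj omega *)

Section FormLemmas.
Variables (R : realType) (n : nat) (M : complex_manifold R n).

(** An (n, 0)-form is determined by its value on d/dz^1, ..., d/dz^n: a word
    containing a d/d(conj z^j) or a repeated index gives 0 on both sides, and
    the remaining words are permutations of the frame. *)
Lemma volume_frame (omega : holomorphic_volume M) c x t : in_chart c setT x ->
  vform omega c x t = vform omega c x (finfun inl) * frame_vol R[i] inl t.
Proof.
move=> Vx; have alt := vform_alternating omega Vx.
have [[i [j tij]]|noinr] := pselect (exists i j, t i = inr j).
  rewrite (vform_type omega Vx tij) (frame_vol_out _ (i := i)) ?mulr0 // => k.
  by rewrite tij.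
have [g tg] : exists g : 'I_n -> 'I_n, forall i, t i = inl (g i).
  have /choice : forall i, exists j, t i = inl j.
    move=> i; case E : (t i) => [j|j]; first by exists j.
    by case: noinr; exists i, j.
  by case=> g tg; exists g.
have [/injectiveP g_inj|/injectivePn [i [j ij gij]]] := boolP (injectiveb g).
  have -> : t = [ffun i => (finfun inl : {ffun 'I_n -> idx n}) (perm g_inj i)].
    by apply/ffunP => i; rewrite !ffunE permE.
  rewrite alt frame_vol_perm frame_vol_frame ?mulr1 1?mulrC //.
  by move=> i j [].
have tij : t i = t j by rewrite !tg gij.
rewrite (frame_vol_repeat _ _ ij tij) mulr0.
have tt : [ffun k => t (tperm i j k)] = t.
  by apply/ffunP => k; rewrite ffunE; case: tpermP => // ->.
have := alt t (tperm i j); rewrite tt odd_tperm ij expr1 mulN1r => /esym /eqP.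
by rewrite eqNr => /eqP.
Qed.

(** The antisymmetrised sum defining the wedge product is a Laplace expansion
    along the first n and the last n columns. *)
Lemma wedge_conj_frame (omega : holomorphic_volume M) c x t :
  in_chart c setT x ->
  wedge omega (form_conj omega) c x t =
    vform omega c x (finfun inl) * conjc (vform omega c x (finfun inl)) *
    frame_vol R[i] (@fintype.split n n) t.
Proof.
move=> Vx; set h := vform omega c x _; rewrite /wedge /form_conj.
pose B := frame_mx R[i] (@fintype.split n n) t.
have El (s : 'S_(n + n)) : vform omega c x [ffun i => t (s (lshift n i))] =
    h * \det (\matrix_(i, j) B (s (lshift n i)) (lshift n j)).
  rewrite volume_frame //; congr (_ * _); congr (\det _); apply/matrixP => i j.
  by rewrite !mxE ffunE (unsplitK (inl j)).
have Er (s : 'S_(n + n)) : conjc (vform omega c x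
      [ffun i => idx_bar ([ffun j => t (s (rshift n j))] i)]) =
    conjc h * \det (\matrix_(i, j) B (s (rshift n i)) (rshift n j)).
  rewrite volume_frame // conjcM -[conjc (frame_vol _ _ _)](det_map_mx (@conjc R)).
  congr (_ * \det _); apply/matrixP => i j.
  rewrite !mxE !ffunE (rmorph_nat (@conjc R)) (unsplitK (inr j)).
  by case: (t _).
under eq_bigr => s _ do rewrite El Er.
transitivity (((n`! * n`!)%:R)^-1 * (h * conjc h * \sum_(s : 'S_(n + n)) (-1) ^+ s *
     \det (\matrix_(i, j) B (s (lshift n i)) (lshift n j)) *
     \det (\matrix_(i, j) B (s (rshift n i)) (rshift n j)))).
  congr (_ * _); rewrite mulr_sumr; apply: eq_bigr => s _.
  move: (\det _) (\det _) ((-1) ^+ s) (conjc h) => d d' sg h'; ring.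
by rewrite det_blocks_antisym mulrCA mulKf // pnatr_eq0 muln_eq0 negb_or
  -!lt0n !fact_gt0.
Qed.

Lemma wirtinger_real_part (u : coords R n -> R) x j :
  wirtinger (inl j) (fun y => (u y)%:C%C) x =
  ((rpartial (inl j) u x)%:C%C - 'i%C * (rpartial (inr j) u x)%:C%C) / 2%:R.
Proof.
by rewrite /wirtinger /cpartial /rpartial /= !derive_cst.
Qed.

(** d/dz^j of f conj f only sees the factor f. *)
Lemma wirtinger_sqmod (V : set (coords R n)) f x j : open V ->
  holomorphic_on V f -> V x ->
  wirtinger (inl j) (fun y => (sqmod (f y))%:C%C) x =
    conjc (f x) * wirtinger (inl j) f x.
Proof.
move=> Vo hf Vx; have sf := holomorphic_csmooth hf; have [_ _ df] := hf.
rewrite (wirtinger_eq_on Vo (g := fun y => f y * conjc (f y)) _ _ Vx); last first.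
  by move=> y _; rewrite sqmodE.
rewrite (wirtingerM Vo) //; last exact: csmooth_on_conj.
rewrite (wirtinger_conj Vo (inr j) sf Vx) df // conjc0 mulr0 addr0.
exact: mulrC.
Qed.

End FormLemmas.

(** * Real Hamiltonian fields of |f|^2 *)

Section RealHamiltonian.
Variables (R : realType) (n : nat) (M : complex_manifold R n).

Lemma sum_idx (F : idx n -> R[i]) :
  \sum_a F a = \sum_(i < n) (F (inl i) + F (inr i)).
Proof. by rewrite big_sumType big_split. Qed.

Lemma complex_sum (I : Type) (r : seq I) (F G : I -> R) :
  ((\sum_(i <- r) F i) +i* (\sum_(i <- r) G i))%C =
  \sum_(i <- r) (F i +i* G i)%C.
Proof.
elim: r => [|i r IH]; first by rewrite !big_nil.
by rewrite !big_cons -IH; simpc.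
Qed.

(** Q is a quarter of the real part of kappa P, in the normalisation of the two
    real Poisson structures.  The x- and y-components of the fields Q(dx^i, .)
    and Q(dy^i, .) are grouped into their components on d/dz^j, which is the
    form needed to compare Hamiltonian fields.  The values kappa = 1 and
    kappa = -i give the real and the imaginary part of P. *)
Definition real_part_at (Q : rbivector M) (P : hbivector M) (kappa : R[i])
    (c : cidx M) (y : coords R n) : Prop :=
  forall i j,
    (Q c y (inl i) (inl j) +i* Q c y (inl i) (inr j))%C =
      kappa * (P c y i j * 4%:R^-1) /\
    (Q c y (inr i) (inl j) +i* Q c y (inr i) (inr j))%C =
      - 'i%C * kappa * (P c y i j * 4%:R^-1).

Lemma quarterE : (4%:R^-1 : R[i]) = (4%:R^-1)%:C%C.
Proof. by rewrite (fmorphV (real_complex R)) (rmorph_nat (real_complex R)). Qed.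

Lemma poissonR_real_part (P : holomorphic_poisson M) c y :
  in_chart c setT y -> real_part_at (poissonR P) P 1 c y.
Proof.
move=> Vy i j; rewrite /poissonR (pbiv_skew P Vy j i) quarterE.
case: (pbiv P c y i j) => a b; simpc => /=.
by split; apply/eqP; rewrite eq_complex /=; apply/andP; split; apply/eqP; ring.
Qed.

Lemma poissonI_real_part (P : holomorphic_poisson M) c y :
  in_chart c setT y -> real_part_at (poissonI P) P (- 'i%C) c y.
Proof.
move=> Vy i j; rewrite /poissonI (pbiv_skew P Vy j i) quarterE.
case: (pbiv P c y i j) => a b; simpc => /=.
by split; apply/eqP; rewrite eq_complex /=; apply/andP; split; apply/eqP; ring.
Qed.

(** Grouping the real partial derivatives of |f|^2 into d/dz^i |f|^2 =
    conj f d/dz^i f, the factor conj f cancels against 1 / |f|^2 and leaves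
    the 1/f of the logarithm. *)
Lemma hamiltonian_sqmod (Q : rbivector M) (P : hbivector M) kappa f c y j :
  holomorphic_fun f -> in_chart c [set p | f p != 0] y ->
  real_part_at Q P kappa c y ->
  cvfield_of_real (rvfield_scale (fun p => (sqmod (f p))^-1)
    (real_hamiltonian Q (fun p => sqmod (f p)))) c y (inl j) =
  kappa / 2%:R * hamiltonian_log P f c y (inl j).
Proof.
move=> hf; rewrite in_chart_nonzero => -[Vy fy] HQ.
have {}fy : loc f c y != 0 := fy.
rewrite /cvfield_of_real /rvfield_scale /real_hamiltonian.
rewrite [loc (fun p => (sqmod (f p))^-1) c y]/loc [loc (fun p => sqmod (f p)) c]/loc.
set u := fun x => sqmod (f (cinv (mchart c) x)).
set s := (sqmod _)^-1.
have -> : ((s * \sum_a Q c y a (inl j) * rpartial a u y) +i*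
   (s * \sum_a Q c y a (inr j) * rpartial a u y))%C =
   s%:C%C * \sum_(i < n) kappa / 2%:R * P c y i j *
     (conjc (loc f c y) * wirtinger (inl i) (loc f c) y).
  transitivity (s%:C%C * ((\sum_a Q c y a (inl j) * rpartial a u y) +i*
      (\sum_a Q c y a (inr j) * rpartial a u y))%C); first by simpc.
  rewrite complex_sum sum_idx; congr (_ * _); apply: eq_bigr => i _.
  rewrite -(wirtinger_sqmod i (@in_chart_openT _ _ _ c) (hf c) Vy) wirtinger_real_part.
  have [H1 H2] := HQ i j.
  have E (p q r : R) : (p * r +i* (q * r))%C = (p +i* q)%C * r%:C%C by simpc.
  rewrite !E H1 H2.
  have -> : (4%:R^-1 : R[i]) = 2%:R^-1 * 2%:R^-1 by rewrite -invfM -natrM.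
  move: (P c y i j) 'i%C (2%:R^-1) => p z h.
  by move: (rpartial _ _ _)%:C%C (rpartial _ _ _)%:C%C => d d'; ring.
have -> : s%:C%C = (loc f c y * conjc (loc f c y))^-1.
  by rewrite /s -sqmodE; exact: (fmorphV (real_complex R)).
rewrite /hamiltonian_log invfM !mulr_sumr; apply: eq_bigr => i _.
have cf0 : conjc (loc f c y) != 0 by rewrite conjc_eq0.
move: (wirtinger _ _ _) (P c y i j) (2%:R^-1) => w p h.
by field; rewrite cf0 fy.
Qed.

End RealHamiltonian.

(** * Last multipliers *)

Section LastMultiplier.
Variables (R : realType) (m : nat) (M : complex_manifold R m.+1).
Variables (P : holomorphic_poisson M) (omega : holomorphic_volume M).
Variables (f alpha : M -> R[i]).
Hypotheses (hf : holomorphic_fun f) (halpha : holomorphic_fun alpha).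
Variable c : cidx M.

Local Notation V := (in_chart c [set p | f p != 0]).
Local Notation W := (in_chart c setT).

Let h (y : coords R m.+1) := vform omega c y (finfun inl).
Let g y := loc alpha c y * h y.
Let F (j : 'I_m.+1) y := g y * hamiltonian_log P f c y (inl j).

(** The divergence of alpha Z_(log f) for the density h of omega, multiplied by
    h. *)
Definition weighted_divergence x := \sum_(j < m.+1) wirtinger (inl j) (F j) x.
Let S := weighted_divergence.

Lemma nonzero_chart_sub : V `<=` W.
Proof. by rewrite in_chart_nonzero => y []. Qed.

Let Wo : open W := @in_chart_openT _ _ _ c.

Lemma nonzero_chart_open : open V.
Proof.
rewrite in_chart_nonzero; apply: open_nonzero; first exact: Wo.
exact: holomorphic_csmooth (hf c).
Qed.
Let Vo := nonzero_chart_open.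

Lemma csmooth_weight : csmooth_on V g.
Proof.
apply: csmooth_on_sub nonzero_chart_sub _.
apply: csmooth_onM; [exact: Wo | exact: holomorphic_csmooth (halpha c) |].
exact: holomorphic_csmooth (vform_holomorphic omega c _).
Qed.
Let sg := csmooth_weight.

(** The weight alpha h is holomorphic, so that its conjugate goes through the
    derivatives d/dz^j. *)
Lemma weight_dbar j x : V x -> wirtinger (inr j) g x = 0.
Proof.
move=> /nonzero_chart_sub Wx.
have [_ _ da] := halpha c; have [_ _ dh] := vform_holomorphic omega c (finfun inl).
rewrite (wirtingerM Wo) //.
- by rewrite da // dh // mul0r mulr0 addr0.
- exact: holomorphic_csmooth (halpha c).
- exact: holomorphic_csmooth (vform_holomorphic omega c _).
Qed.

Lemma csmooth_hamiltonian_log a :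
  csmooth_on V (fun y => hamiltonian_log P f c y a).
Proof.
case: a => j; last exact: csmooth_on_cst.
apply: csmooth_onM => //.
  apply: csmooth_onV => //; first by rewrite in_chart_nonzero => y [].
  apply: csmooth_on_sub nonzero_chart_sub _.
  exact: holomorphic_csmooth (hf c).
apply: csmooth_on_sub nonzero_chart_sub _.
apply: csmooth_on_sum => // i; apply: csmooth_onM => //.
  exact: holomorphic_csmooth (pbiv_holomorphic P c i j).
apply: csmooth_on_wirtinger => //.
exact: holomorphic_csmooth (hf c).
Qed.

Lemma csmooth_flux j : csmooth_on V (F j).
Proof.
by apply: csmooth_onM => //; exact: csmooth_hamiltonian_log.
Qed.

Lemma del_hamiltonian_log x t : V x ->
  del (form_scale alpha (Defs.interior (hamiltonian_log P f) omega)) c x t =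
  frame_vol R[i] inl t * S x.
Proof.
move=> Vx.
have inl_inj : injective (@inl 'I_m.+1 'I_m.+1) by move=> i j [].
rewrite -(top_form_divergence Vo inl_inj
  (G := fun a y => g y * hamiltonian_log P f c y a)
  (p := fun a => if a is inl _ then true else false) t _ Vx); first last.
- case=> j; first by apply/esym/existsP; exists j.
  by apply/esym/existsP => -[].
- by move=> a; apply: csmooth_onM => //; exact: csmooth_hamiltonian_log.
rewrite /del; apply: eq_bigr => i _; congr (_ * _).
have E y : V y -> form_scale alpha
    (Defs.interior (hamiltonian_log P f) omega) c y (idx_del i t) =
   \sum_(a : idx m.+1) g y * hamiltonian_log P f c y a *
       frame_vol R[i] inl (idx_cons a (idx_del i t)).
  move=> /nonzero_chart_sub Wy.
  rewrite /form_scale /Defs.interior mulr_sumr; apply: eq_bigr => a _.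
  rewrite volume_frame // /g /h.
  move: (loc alpha c y) (vform omega c y _) (frame_vol _ _ _) => p q r.
  by move: (hamiltonian_log _ _ _ _ _) => z; ring.
by case: (t i) => // j; exact: (wirtinger_eq_on Vo _ E Vx).
Qed.

(** The components of the real field on d/d(conj z^j) are conjugate to those on
    d/dz^j, so its divergence is T + conj T.  The density of the multiplier and
    of omega /\ conj omega is g conj g with g = alpha h, and conj g comes out of
    T because it is antiholomorphic. *)
Lemma extd_real_hamiltonian (Q : rbivector M) kappa x t : V x ->
  (forall y, V y -> real_part_at Q P kappa c y) ->
  let T := kappa / 2%:R * (conjc (g x) * S x) in
  extd (form_scale (fun p => (sqmod (alpha p))%:C%C)
    (Defs.interior (cvfield_of_real (rvfield_scale (fun p => (sqmod (f p))^-1)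
        (real_hamiltonian Q (fun p => sqmod (f p)))))
      (wedge omega (form_conj omega)))) c x t =
  frame_vol R[i] (@fintype.split m.+1 m.+1) t * (T + conjc T).
Proof.
move=> Vx HQ T; set X := cvfield_of_real _.
pose G a y := (sqmod (alpha (cinv (mchart c) y)))%:C%C * (h y * conjc (h y)) * X c y a.
have Gl j y : V y -> G (inl j) y = kappa / 2%:R * (conjc (g y) * F j y).
  move=> Vy; rewrite /G /X (hamiltonian_sqmod j hf Vy (HQ y Vy)) sqmodE /F /g.
  rewrite conjcM /loc.
  move: (alpha _) (h y) (hamiltonian_log _ _ _ _ _) => p q r.
  by move: (conjc p) (conjc q) (2%:R^-1) => p' q' k; ring.
have Gr j y : G (inr j) y = conjc (G (inl j) y).
  by rewrite /G !conjcM conjcK conjc_real (mulrC (h y)).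
have sGl j : csmooth_on V (G (inl j)).
  apply: (@csmooth_on_eq _ _ V Vo (fun y => kappa / 2%:R * (conjc (g y) * F j y))).
    by move=> y Vy; rewrite Gl.
  apply: csmooth_onM => //; first exact: csmooth_on_cst.
  by apply: csmooth_onM => //; [exact: csmooth_on_conj | exact: csmooth_flux].
have sG a : csmooth_on V (G a).
  case: a => j //.
  apply: (@csmooth_on_eq _ _ V Vo (fun y => conjc (G (inl j) y))).
    by move=> y _; rewrite Gr.
  exact: csmooth_on_conj.
have dGl j : wirtinger (inl j) (G (inl j)) x =
    kappa / 2%:R * (conjc (g x) * wirtinger (inl j) (F j) x).
  rewrite (wirtinger_eq_on Vo _ (Gl j) Vx).
  rewrite (wirtingerM Vo _ (csmooth_on_cst Vo _)) //; last first.
    by apply: csmooth_onM => //; [exact: csmooth_on_conj | exact: csmooth_flux].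
  rewrite wirtinger_cst mul0r add0r; congr (_ * _).
  rewrite (wirtingerM Vo) //; [|exact: csmooth_on_conj|exact: csmooth_flux].
  by rewrite (wirtinger_conj Vo (inr j) sg Vx) weight_dbar // conjc0 mul0r add0r.
have split_inj : injective (@fintype.split m.+1 m.+1) by exact: can_inj (@splitK _ _).
(* fintype.split lists the frame d/dz^1, ..., d/dz^n, d/d(conj z^1), ... in the
   order used by wedge_conj_frame *)
have -> : T + conjc T =
    \sum_(k < m.+1 + m.+1) wirtinger (@fintype.split m.+1 m.+1 k)
      (G (@fintype.split m.+1 m.+1 k)) x.
  rewrite big_split_ord; congr (_ + _).
    rewrite /T /S /weighted_divergence !mulr_sumr; apply: eq_bigr => j _.
    by rewrite (unsplitK (inl j)) dGl.
  rewrite /T /S /weighted_divergence !mulr_sumr.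
  rewrite (rmorph_sum (@conjc R)); apply: eq_bigr => j _.
  rewrite (unsplitK (inr j)) (wirtinger_eq_on Vo _ (fun y _ => Gr j y) Vx).
  by rewrite (wirtinger_conj Vo (inl j) (sGl j) Vx) dGl.
rewrite -(top_form_divergence (m := m + m.+1) Vo split_inj
  (p := predT) t sG Vx); last first.
  move=> a; apply/esym/existsP; exists (unsplit a); by rewrite unsplitK.
rewrite /extd /del /delbar -big_split; apply: eq_bigr => i _.
rewrite -[LHS]mulrDr; congr (_ * _).
have E y : V y -> form_scale (fun p => (sqmod (alpha p))%:C%C)
    (Defs.interior X (wedge omega (form_conj omega))) c y (idx_del i t) =
   \sum_(a : idx m.+1) G a y *
       frame_vol R[i] (@fintype.split m.+1 m.+1) (idx_cons a (idx_del i t)).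
  move=> /nonzero_chart_sub Wy.
  rewrite /form_scale [Defs.interior _ _]/Defs.interior /= mulr_sumr; apply: eq_bigr => a _.
  rewrite wedge_conj_frame // /G /loc -/(h y).
  move: (_ %:C%C) (h y) (conjc _) (X c y a) (frame_vol _ _ _) => p q r s w.
  ring.
case: (t i) => j; rewrite ?addr0 ?add0r.
  exact: (wirtinger_eq_on Vo _ E Vx).
exact: (wirtinger_eq_on Vo _ E Vx).
Qed.

(** The zeros of g = alpha h do no harm: if S x were nonzero, g would vanish
    on a neighbourhood of x, where S, built from derivatives of g Z^j, would
    then vanish too. *)
Lemma weighted_divergence_eq0 :
  (forall x, V x -> conjc (g x) * S x = 0) -> forall x, V x -> S x = 0.
Proof.
move=> gS x Vx; apply/eqP; apply: contraT => Sx.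
have sS : csmooth_on V S.
  apply: csmooth_on_sum => // j; apply: csmooth_on_wirtinger => //.
  exact: csmooth_flux.
have Oo := open_nonzero Vo sS; have Ox : (V `&` [set y | S y != 0]) x by split.
move: Sx; rewrite /S /weighted_divergence big1 ?eqxx // => j _.
have F0 y : (V `&` [set y | S y != 0]) y -> F j y = 0.
  move=> [Vy Sy]; have /eqP := gS y Vy.
  rewrite mulf_eq0 (negPf (Sy : S y != 0)) orbF conjc_eq0 => /eqP gy.
  by rewrite /F gy mul0r.
exact: etrans (wirtinger_eq_on Oo _ F0 Ox) (wirtinger_cst 0 x (inl j)).
Qed.

End LastMultiplier.

(** The two equations say that the real and the imaginary part of w vanish. *)
Lemma eq0_of_real_parts (R : realType) (w : R[i]) :
  1 / 2%:R * w + conjc (1 / 2%:R * w) = 0 ->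
  - 'i%C / 2%:R * w + conjc (- 'i%C / 2%:R * w) = 0 -> w = 0.
Proof.
rewrite !conjcM conjc_half conjc1 -conjc_i conjcK conjc_i => H1 H2.
have -> : w = (1 / 2%:R * w + 1 / 2%:R * conjc w) +
   'i%C * (- 'i%C / 2%:R * w + 'i%C / 2%:R * conjc w).
  have i2 : 'i%C * 'i%C = -1 :> R[i] by rewrite -expr2 sqr_i.
  (* ring does not know i^2 = -1, hence the explicit factor i * i *)
  have -> : 'i%C * (- 'i%C / 2%:R * w + 'i%C / 2%:R * conjc w) =
     ('i%C * 'i%C) * (2%:R^-1 * (conjc w - w)).
    by move: 'i%C (2%:R^-1) (conjc w) => i h v; ring.
  by rewrite i2; move: (conjc w) => v; field.
by rewrite H1 H2 mulr0 addr0.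
Qed.

Theorem theorem3p1 (R : realType) (n : nat) (M : complex_manifold R n)
  (P : holomorphic_poisson M) (omega : holomorphic_volume M)
  (f alpha : M -> R[i])
  (hf : holomorphic_fun f) (halpha : holomorphic_fun alpha) :
  holomorphic_last_multiplier omega [set p | f p != 0]
    (hamiltonian_log P f) alpha
  <->
  real_last_multiplier omega [set p | f p != 0]
    (rvfield_scale (fun p => (sqmod (f p))^-1)
      (real_hamiltonian (poissonR P) (fun p => sqmod (f p))))
    (fun p => sqmod (alpha p))
  /\
  real_last_multiplier omega [set p | f p != 0]
    (rvfield_scale (fun p => (sqmod (f p))^-1)
      (real_hamiltonian (poissonI P) (fun p => sqmod (f p))))
    (fun p => sqmod (alpha p)).
Proof.
have smooth_alpha : smooth_fun (fun p => sqmod (alpha p)).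
  move=> c; have := smooth_on_sqmod (@in_chart_openT _ _ _ c).
  by apply; exact: holomorphic_csmooth (halpha c).
case: n M P omega f alpha hf halpha smooth_alpha
  => [|m] M P omega f alpha hf halpha smooth_alpha.
  (* in dimension 0 there are no frame vectors on which to test the forms *)
  have no_frame (k : nat) (t : {ffun 'I_k.+1 -> idx 0}) : False.
    by case: (t ord0) => -[].
  split=> _; first split; split=> // c x _ t; case: (no_frame _ t).
split=> [[_ del0]|[[_ extd0R] [_ extd0I]]].
  have S0 c x : in_chart c [set p | f p != 0] x ->
      weighted_divergence P omega f alpha c x = 0.
    move=> Vx; have := del0 c x Vx (finfun inl).
    rewrite (del_hamiltonian_log _ _ hf halpha) // frame_vol_frame ?mul1r //.
    by move=> i j [].
  split; split=> // c x Vx t.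
    rewrite (extd_real_hamiltonian (P := P) _ hf halpha (kappa := 1)) //.
      by rewrite S0 // !mulr0 conjc0 addr0 mulr0.
    by move=> y /nonzero_chart_sub; exact: poissonR_real_part.
  rewrite (extd_real_hamiltonian (P := P) _ hf halpha (kappa := - 'i%C)) //.
    by rewrite S0 // !mulr0 conjc0 addr0 mulr0.
  by move=> y /nonzero_chart_sub; exact: poissonI_real_part.
split=> // c x Vx t.
rewrite (del_hamiltonian_log _ _ hf halpha) //.
rewrite (weighted_divergence_eq0 hf halpha _ Vx) ?mulr0 // => y Vy.
pose t0 : {ffun 'I_(m.+1 + m.+1) -> idx m.+1} := finfun (@fintype.split m.+1 m.+1).
have t0E : frame_vol R[i] (@fintype.split m.+1 m.+1) t0 = 1.
  by apply: frame_vol_frame; exact: can_inj (@splitK _ _).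
suff : conjc (loc alpha c y * vform omega c y (finfun inl)) *
    weighted_divergence P omega f alpha c y = 0 by [].
apply: eq0_of_real_parts.
  have := extd0R c y Vy t0.
  rewrite (extd_real_hamiltonian (P := P) _ hf halpha (kappa := 1)) //.
    by rewrite t0E mul1r.
  by move=> z /nonzero_chart_sub; exact: poissonR_real_part.
have := extd0I c y Vy t0.
rewrite (extd_real_hamiltonian (P := P) _ hf halpha (kappa := - 'i%C)) //.
  by rewrite t0E mul1r.
by move=> z /nonzero_chart_sub; exact: poissonI_real_part.
Qed.
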